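(* Let $N\in\mathbb{N}$, let $\boldsymbol{K}\in\mathbb{R}^{N\times N}$ be a convolution matrix, let $\tau>0$, let $g$ be a diffusivity, and let $\boldsymbol{\Phi}$ denote the componentwise application of the flux function $\Phi(s)=g(s^2)\,s$. Assume that $\Phi$ is Lipschitz continuous with finite Lipschitz constant $L$. Consider a residual network that chains any number of diffusion blocks $$\boldsymbol{u}^{k+1}=\boldsymbol{u}^k-\tau\,\boldsymbol{K}^\top\boldsymbol{\Phi}\left(\boldsymbol{K}\boldsymbol{u}^k\right),$$ with convolutions represented by $\boldsymbol{K}$ and activation function $\tau\boldsymbol{\Phi}$, started from the input $\boldsymbol{u}^0=\boldsymbol{f}\in\mathbb{R}^N$. If $$\tau\le 2\left(L\,\|\boldsymbol{K}\|_2^2\right)^{-1},$$ then the residual network is well-posed, i.e. its output is a continuous function of the input data $\boldsymbol{f}$, and it is stable in the Euclidean norm, i.e. $\|\boldsymbol{u}^{k+1}\|_2\le\|\boldsymbol{u}^k\|_2$ holds for every block. Here the norm $\|\boldsymbol{K}\|_2$ of the matrix is the spectral norm induced by the Euclidean norm.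
   Context: A diffusivity is a function $g:[0,\infty)\to\mathbb{R}$ that is smooth, nonnegative, nonincreasing, and bounded from above. The associated flux function is $\Phi:\mathbb{R}\to\mathbb{R}$, $\Phi(s)=g(s^2)\,s$; for a vector $\boldsymbol{v}\in\mathbb{R}^N$, $\boldsymbol{\Phi}(\boldsymbol{v})$ has components $\Phi(v_i)$. The convolution matrix $\boldsymbol{K}$ is a real matrix representing a discrete convolution, which discretises a differential operator $\mathcal{D}=\sum_{m=0}^M\alpha_m\partial_x^m$ on an interval $(a,b)$ sampled at $N$ points (with reflecting boundary conditions); $\boldsymbol{K}^\top$ is its transpose. A diffusion block is the residual block $\boldsymbol{f}\mapsto\sigma_2(\boldsymbol{f}+\boldsymbol{W}_2\,\sigma_1(\boldsymbol{W}_1\boldsymbol{f}+\boldsymbol{b}_1)+\boldsymbol{b}_2)$ with $\sigma_1=\tau\boldsymbol{\Phi}$, $\sigma_2=\mathrm{Id}$, $\boldsymbol{W}_1=\boldsymbol{K}$, $\boldsymbol{W}_2=-\boldsymbol{K}^\top$, $\boldsymbol{b}_1=\boldsymbol{b}_2=\boldsymbol{0}$, i.e. the map $\boldsymbol{u}^k\mapsto\boldsymbol{u}^k-\tau\boldsymbol{K}^\top\boldsymbol{\Phi}(\boldsymbol{K}\boldsymbol{u}^k)$. Chaining blocks means composing these maps. *)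

(* Defs.v *)
(* MathComp-Analysis *)
From HB Require Import structures.
From mathcomp Require Import all_boot all_order all_algebra.
From mathcomp Require Import all_classical all_reals all_analysis.
Set Implicit Arguments.
Unset Strict Implicit.
Unset Printing Implicit Defensive.
Import Order.TTheory GRing.Theory Num.Theory.
Import numFieldNormedType.Exports.
Local Open Scope classical_set_scope.
Local Open Scope ring_scope.

Definition smooth (R : realType) (f : R -> R) : Prop :=
  forall (m : nat) (x : R), derivable (derive1n m f) x 1.

(* A function on [0, +oo[ is represented by a total function whose values at
   negative arguments are irrelevant; it is smooth up to the boundary point 0
   when it is the restriction of a smooth function on the real line. *)
Definition smooth_nonneg (R : realType) (g : R -> R) : Prop :=
  exists2 G : R -> R, smooth G & forall s, 0 <= s -> g s = G s.

Record diffusivity (R : realType) (g : R -> R) : Prop := Diffusivity {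
  diffusivity_smooth : smooth_nonneg g;
  diffusivity_ge0 : forall s, 0 <= s -> 0 <= g s;
  diffusivity_nonincreasing : forall s t, 0 <= s -> s <= t -> g t <= g s;
  diffusivity_bounded : has_ubound [set g s | s in [set s | 0 <= s]]
}.

Definition flux (R : realType) (g : R -> R) (s : R) : R := g (s ^+ 2) * s.

(* A stencil of radius r has 2r+1 weights; the weight number l sits at the
   offset l - r. *)
Definition offset (r : nat) (l : 'I_(r.*2.+1)) : int := l%:Z - r%:Z.

(* Reflecting boundary: cells 0, ..., N-1 are mirrored at the cell faces -1/2
   and N-1/2, so that u_(-1) = u_0, u_N = u_(N-1), and so on with period 2N. *)
Definition reflect_index (N : nat) (k : int) : nat :=
  let m := `|(k %% (N.*2)%:Z)%Z|%N in if (m < N)%N then m else (N.*2.-1 - m)%N.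

(* (conv_mx N w *m u)_i = \sum_l w_l u_(i - offset l), with u extended by
   reflection; several offsets may be mirrored to the same column. *)
Definition conv_mx (R : realType) (N r : nat) (w : 'I_(r.*2.+1) -> R) :
    'M[R]_N :=
  \matrix_(i, j) \sum_(l | reflect_index N (i%:Z - offset l) == j) w l.

Definition diff_op (R : realType) (M : nat) (alpha : 'I_M.+1 -> R)
    (f : R -> R) (x : R) : R :=
  \sum_(m < M.+1) alpha m * derive1n m f x.

(* A finite difference scheme gives a stencil w h for every grid size h; it
   discretises the operator with coefficients alpha when it is consistent. *)
Definition consistent (R : realType) (a b : R) (M : nat) (alpha : 'I_M.+1 -> R)
    (r : nat) (w : R -> 'I_(r.*2.+1) -> R) : Prop :=
  forall f : R -> R, smooth f -> forall x, a < x < b ->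
    (\sum_l w h l * f (x - (offset l)%:~R * h)) @[h --> 0^'+]
      --> diff_op alpha f x.

(* N cells of width (b - a) / N; the samples are the values at the centres. *)
Definition convolution_matrix (R : realType) (a b : R) (M : nat)
    (alpha : 'I_M.+1 -> R) (N : nat) (K : 'M[R]_N) : Prop :=
  exists (r : nat) (w : R -> 'I_(r.*2.+1) -> R),
    consistent a b alpha w /\ K = conv_mx N (w ((b - a) / N%:R)).

(* The library norm on matrices is the maximum norm, hence these two. *)
Definition norm2 (R : realType) (N : nat) (v : 'cV[R]_N) : R :=
  Num.sqrt (\sum_i v i 0 ^+ 2).

Definition spectral_norm (R : realType) (N : nat) (K : 'M[R]_N) : R :=
  sup [set norm2 (K *m v) | v in [set v : 'cV[R]_N | norm2 v <= 1]].

Definition residual_block (R : realType) (N : nat) (sigma1 sigma2 : R -> R)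
    (W1 W2 : 'M[R]_N) (b1 b2 : 'cV[R]_N) (f : 'cV[R]_N) : 'cV[R]_N :=
  map_mx sigma2 (f + W2 *m map_mx sigma1 (W1 *m f + b1) + b2).

Definition diffusion_block (R : realType) (N : nat) (tau : R) (K : 'M[R]_N)
    (g : R -> R) : 'cV[R]_N -> 'cV[R]_N :=
  residual_block (fun s => tau * flux g s) id K (- K^T) 0 0.

Lemma diffusion_blockE (R : realType) (N : nat) (tau : R) (K : 'M[R]_N)
    (g : R -> R) (u : 'cV[R]_N) :
  diffusion_block tau K g u = u - tau *: (K^T *m map_mx (flux g) (K *m u)).
Proof.
rewrite /diffusion_block /residual_block !addr0 map_mx_id //.
rewrite mulNmx scalemxAr; congr (_ - _ *m _).
by apply/matrixP => i j; rewrite !mxE.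
Qed.

Definition diffusion_network (R : realType) (N : nat) (tau : R) (K : 'M[R]_N)
    (g : R -> R) (n : nat) : 'cV[R]_N -> 'cV[R]_N :=
  iter n (diffusion_block tau K g).

(* Main.v *)
Require Import Defs.
From HB Require Import structures.
From mathcomp Require Import all_boot all_order all_algebra.
From mathcomp Require Import all_classical all_reals all_analysis.
From mathcomp Require Import ring lra.
Import Order.TTheory GRing.Theory Num.Theory.
Import numFieldNormedType.Exports.
Local Open Scope classical_set_scope.
Local Open Scope ring_scope.

(** Write v = K u and p = Phi(v). Expanding the square of the Euclidean norm
    of one block gives
      |u - tau K^T p|^2 = |u|^2 - 2 tau <v, p> + tau^2 |K^T p|^2,
    since <u, K^T p> = <v, p>. The last term is controlled by two facts: K^T
    is bounded by the spectral norm of K ([norm2_trmx_mulmx_le]), and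
    |p|^2 <= L <v, p> ([sqr_flux_le], summed over the components), because
    each p_i has the sign of v_i and |p_i| <= L |v_i|. Hence
      tau^2 |K^T p|^2 <= tau (tau L |K|^2) <v, p> <= 2 tau <v, p>
    under the bound on tau, so the norm cannot grow.

    Continuity is inherited by composition: Phi is Lipschitz, and a map into
    matrices is continuous as soon as its entries are. *)

(** * Euclidean inner product and spectral norm *)

Definition dot {R : realType} {N : nat} (u v : 'cV[R]_N) : R :=
  (u^T *m v) 0 0.

Lemma dotE {R : realType} {N : nat} (u v : 'cV[R]_N) :
  dot u v = \sum_i u i 0 * v i 0.
Proof. by rewrite /dot mxE; apply: eq_bigr => i _; rewrite mxE. Qed.

Lemma dotC {R : realType} {N : nat} (u v : 'cV[R]_N) : dot u v = dot v u.
Proof. by rewrite !dotE; apply: eq_bigr => i _; rewrite mulrC. Qed.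

Lemma dotBr {R : realType} {N : nat} (u v w : 'cV[R]_N) :
  dot u (v - w) = dot u v - dot u w.
Proof. by rewrite /dot mulmxBr !mxE. Qed.

Lemma dotZr {R : realType} {N : nat} (u v : 'cV[R]_N) (c : R) :
  dot u (c *: v) = c * dot u v.
Proof. by rewrite /dot -scalemxAr !mxE. Qed.

Lemma dot_trmx {R : realType} {N : nat} (A : 'M[R]_N) (u v : 'cV[R]_N) :
  dot u (A^T *m v) = dot (A *m u) v.
Proof. by rewrite /dot trmx_mul mulmxA. Qed.

Lemma dot_subZ {R : realType} {N : nat} (u v : 'cV[R]_N) (c : R) :
  dot (u - c *: v) (u - c *: v)
    = dot u u - 2 * c * dot u v + c ^+ 2 * dot v v.
Proof.
by rewrite dotBr dotZr !(dotC (u - _)) !dotBr !dotZr (dotC v u); ring.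
Qed.

Lemma dot_ge0 {R : realType} {N : nat} (u : 'cV[R]_N) : 0 <= dot u u.
Proof. by rewrite dotE; apply: sumr_ge0 => i _; rewrite -expr2 sqr_ge0. Qed.

Lemma dot_eq0 {R : realType} {N : nat} (u : 'cV[R]_N) :
  (dot u u == 0) = (u == 0).
Proof.
apply/idP/eqP => [|->]; last by rewrite /dot mulmx0 mxE.
rewrite dotE psumr_eq0 => [/allP u0|i _]; last by rewrite -expr2 sqr_ge0.
apply/colP => i; rewrite mxE; apply/eqP.
by have := u0 i (mem_index_enum i); rewrite /= mulf_eq0 orbb.
Qed.

Lemma dot_CauchySchwarz {R : realType} {N : nat} (u v : 'cV[R]_N) :
  dot u v ^+ 2 <= dot u u * dot v v.
Proof.
have [->|u_neq0] := eqVneq u 0.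
  by rewrite /dot trmx0 !mul0mx mxE expr0n mul0r.
have uu_gt0 : 0 < dot u u by rewrite lt0r dot_eq0 u_neq0 dot_ge0.
(* The component of v orthogonal to u has a nonnegative square. *)
have := dot_ge0 (v - (dot u v / dot u u) *: u).
rewrite dot_subZ (dotC v u).
have -> : dot v v - 2 * (dot u v / dot u u) * dot u v
    + (dot u v / dot u u) ^+ 2 * dot u u
  = dot v v - dot u v ^+ 2 / dot u u by field; rewrite gt_eqF.
by rewrite subr_ge0 ler_pdivrMr// mulrC.
Qed.

Lemma norm2E {R : realType} {N : nat} (u : 'cV[R]_N) :
  norm2 u = Num.sqrt (dot u u).
Proof.
by rewrite /norm2 dotE; congr Num.sqrt; apply: eq_bigr => i _; rewrite expr2.
Qed.

Lemma norm2_ge0 {R : realType} {N : nat} (u : 'cV[R]_N) : 0 <= norm2 u.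
Proof. exact: sqrtr_ge0. Qed.

Lemma sqr_norm2 {R : realType} {N : nat} (u : 'cV[R]_N) :
  norm2 u ^+ 2 = dot u u.
Proof. by rewrite norm2E sqr_sqrtr// dot_ge0. Qed.

Lemma norm2Z {R : realType} {N : nat} (c : R) (u : 'cV[R]_N) :
  norm2 (c *: u) = `|c| * norm2 u.
Proof.
rewrite !norm2E dotZr dotC dotZr mulrA -expr2.
by rewrite sqrtrM ?sqr_ge0// sqrtr_sqr.
Qed.

Lemma norm2_eq0 {R : realType} {N : nat} (u : 'cV[R]_N) :
  (norm2 u == 0) = (u == 0).
Proof. by rewrite -sqrf_eq0 sqr_norm2 dot_eq0. Qed.

Lemma dot_le_norm2 {R : realType} {N : nat} (u v : 'cV[R]_N) :
  dot u v <= norm2 u * norm2 v.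
Proof.
rewrite (le_trans (ler_norm _))// -ler_sqr ?nnegrE ?mulr_ge0 ?norm2_ge0//.
by rewrite exprMn !sqr_norm2 real_normK ?num_real// dot_CauchySchwarz.
Qed.

(** Cauchy-Schwarz on each row bounds the image of the unit ball by the
    Frobenius norm; this makes the supremum defining the spectral norm
    a genuine one. *)
Lemma spectral_norm_has_ubound {R : realType} {N : nat} (K : 'M[R]_N) :
  has_ubound [set norm2 (K *m v) | v in [set v : 'cV[R]_N | norm2 v <= 1]].
Proof.
exists (Num.sqrt (\sum_i dot (row i K)^T (row i K)^T)) => _ [v /= v1 <-].
rewrite norm2E ler_wsqrtr// dotE; apply: ler_sum => i _.
have -> : (K *m v) i 0 = dot (row i K)^T v.
  by rewrite /dot trmxK -row_mul [RHS]mxE.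
rewrite -expr2 (le_trans (dot_CauchySchwarz _ _))//.
by rewrite ler_piMr ?dot_ge0// -sqr_norm2 expr_le1 ?norm2_ge0.
Qed.

Lemma spectral_norm_ge0 {R : realType} {N : nat} (K : 'M[R]_N) :
  0 <= spectral_norm K.
Proof.
apply: le_trans (norm2_ge0 (K *m 0)) _.
apply: (ub_le_sup (spectral_norm_has_ubound K)); exists 0 => //=.
by rewrite (_ : norm2 0 = 0) ?ler01//; apply/eqP; rewrite norm2_eq0.
Qed.

Lemma norm2_mulmx_le {R : realType} {N : nat} (K : 'M[R]_N) (v : 'cV[R]_N) :
  norm2 (K *m v) <= spectral_norm K * norm2 v.
Proof.
have [->|v_neq0] := eqVneq v 0.
  by rewrite mulmx0 (eqP (_ : norm2 0 == 0)) ?mulr0// norm2_eq0.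
have nv_gt0 : 0 < norm2 v by rewrite lt0r norm2_eq0 v_neq0 norm2_ge0.
rewrite -ler_pdivrMr// mulrC -[(norm2 v)^-1]gtr0_norm ?invr_gt0//.
rewrite -norm2Z scalemxAr.
apply: (ub_le_sup (spectral_norm_has_ubound K)).
exists ((norm2 v)^-1 *: v) => //=.
by rewrite norm2Z gtr0_norm ?invr_gt0// mulVf ?gt_eqF.
Qed.

(** The spectral norm of the transpose is controlled without any spectral
    theory: |K^T w|^2 = <K K^T w, w> <= |K| |K^T w| |w|, and one factor
    |K^T w| cancels. *)
Lemma norm2_trmx_mulmx_le {R : realType} {N : nat} (K : 'M[R]_N)
    (w : 'cV[R]_N) :
  norm2 (K^T *m w) <= spectral_norm K * norm2 w.
Proof.
have [KTw0|KTw_neq0] := eqVneq (norm2 (K^T *m w)) 0.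
  by rewrite KTw0 mulr_ge0 ?spectral_norm_ge0 ?norm2_ge0.
have KTw_gt0 : 0 < norm2 (K^T *m w) by rewrite lt0r KTw_neq0 norm2_ge0.
rewrite -(ler_pM2l KTw_gt0) -expr2 sqr_norm2 dot_trmx.
rewrite (le_trans (dot_le_norm2 _ _))// mulrCA mulrA.
by rewrite ler_wpM2r ?norm2_ge0// norm2_mulmx_le.
Qed.

(** * The flux function *)

Lemma flux_lipschitz_le {R : realType} (g : R -> R) (L : R) :
  L.-lipschitz (flux g) -> forall s, `|flux g s| <= L * `|s|.
Proof.
move=> hL s; have := hL (s, 0) (conj I I).
by rewrite /self_sub/= /flux mulr0 !subr0.
Qed.

(** The flux points in the direction of its argument because g is nonnegative,
    so one factor of its square can be bounded by the Lipschitz constant while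
    the other keeps its sign. *)
Lemma sqr_flux_le {R : realType} (g : R -> R) (L : R) :
  (forall s, 0 <= s -> 0 <= g s) -> L.-lipschitz (flux g) ->
  forall s, flux g s ^+ 2 <= L * (s * flux g s).
Proof.
move=> g_ge0 hL s.
have sflux_ge0 : 0 <= s * flux g s.
  by rewrite /flux mulrCA -expr2 mulr_ge0 ?g_ge0 ?sqr_ge0.
rewrite -[s * _]ger0_norm// normrM mulrA -real_normK ?num_real// expr2.
by rewrite ler_wpM2r// flux_lipschitz_le.
Qed.

Lemma klipschitz_continuous {R : realType} (f : R -> R) (L : R) :
  L.-lipschitz f -> continuous f.
Proof.
move=> fL x; apply/cvgrPdist_le => e e_gt0.
have L1_gt0 : 0 < `|L| + 1 by rewrite ltr_wpDl.
(* L itself may vanish; |L| + 1 is a positive Lipschitz constant. *)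
near=> y.
have := fL (x, y) (conj I I); rewrite /self_sub/= => /le_trans; apply.
rewrite (@le_trans _ _ ((`|L| + 1) * `|x - y|))//.
  by rewrite ler_wpM2r// (le_trans (ler_norm L))// lerDl.
rewrite mulrC -ler_pdivlMr//; near: y.
by apply: cvgr_dist_le; [exact: cvg_id | rewrite divr_gt0].
Unshelve. all: by end_near. Qed.

(** * Continuity of a diffusion block *)

(** A neighbourhood of a matrix contains a product of neighbourhoods of its
    finitely many entries, so finitely many entrywise conditions suffice. *)
Lemma continuous_mx {R : realType} {T : topologicalType} {m n : nat}
    (f : T -> 'M[R]_(m, n)) :
  (forall i j, continuous (fun x => f x i j)) -> continuous f.
Proof.
move=> cf x A [P Pnbhs PA]; rewrite /nbhs/=.
have : \forall y \near x, forall i j, P i j (f y i j).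
  apply: filter_forall => i; apply: filter_forall => j.
  exact: (cf i j x _ (Pnbhs i j)).
by apply: filterS => y Py; apply: PA.
Qed.

Lemma continuous_mulmx {R : realType} {m n p : nat} (A : 'M[R]_(m, n)) :
  continuous (fun u : 'M[R]_(n, p) => A *m u).
Proof.
apply: continuous_mx => i j.
rewrite (_ : (fun _ => _) = fun u : 'M[R]_(n, p) => \sum_k A i k * u k j).
  move=> u; apply: (cvg_big add_continuous (F := nbhs u)) => k _.
  by apply: cvgMl_tmp; exact: coord_continuous.
by apply/funext => u; rewrite mxE.
Qed.

Lemma continuous_map_mx {R : realType} {m n : nat} (f : R -> R) :
  continuous f -> continuous (fun u : 'M[R]_(m, n) => map_mx f u).
Proof.
move=> cf; apply: continuous_mx => i j.
rewrite (_ : (fun _ => _) = fun u : 'M[R]_(m, n) => f (u i j)).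
  by move=> u; apply: continuous_comp; [exact: coord_continuous | exact: cf].
by apply/funext => u; rewrite mxE.
Qed.

Lemma continuous_diffusion_block {R : realType} {N : nat} (tau : R)
    (K : 'M[R]_N) (g : R -> R) :
  continuous (flux g) -> continuous (diffusion_block tau K g).
Proof.
move=> cflux; rewrite (_ : diffusion_block tau K g =
    fun u => u - tau *: (K^T *m map_mx (flux g) (K *m u))); last first.
  by apply/funext => u; exact: diffusion_blockE.
move=> u; apply: (@cvgB _ _ _ (nbhs u)); first exact: cvg_id.
apply: (@cvgZl_tmp _ _ _ (nbhs u)).
apply: (@continuous_comp _ _ _ (map_mx (flux g) \o mulmx K) (mulmx K^T)).
  apply: continuous_comp; first exact: continuous_mulmx.
  exact: continuous_map_mx.
exact: continuous_mulmx.
Qed.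

(** * Stability of a diffusion block *)

(** The inverse of 0 is +oo in the extended reals, so the step size is
    unrestricted when L |K|^2 = 0; the product form covers that case too. *)
Lemma step_size_le {R : realType} (tau c : R) :
  0 <= c -> (tau%:E <= 2%:E * (c%:E)^-1)%E -> tau * c <= 2.
Proof.
rewrite le_eqVlt => /predU1P[<- _|c_gt0]; first by rewrite mulr0.
by rewrite inver gt_eqF// -EFinM lee_fin ler_pdivlMr.
Qed.

Lemma diffusion_block_norm2_le {R : realType} {N : nat} (K : 'M[R]_N)
    (tau L : R) (g : R -> R) (u : 'cV[R]_N) :
  0 < tau -> (forall s, 0 <= s -> 0 <= g s) -> L.-lipschitz (flux g) ->
  tau * (L * spectral_norm K ^+ 2) <= 2 ->
  norm2 (diffusion_block tau K g u) <= norm2 u.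
Proof.
move=> tau_gt0 g_ge0 hL tau_le; rewrite diffusion_blockE !norm2E ler_wsqrtr//.
set p := map_mx _ _; set S := spectral_norm K in tau_le *.
rewrite dot_subZ dot_trmx.
have vp_ge0 : 0 <= dot (K *m u) p.
  rewrite dotE; apply: sumr_ge0 => i _.
  by rewrite [p _ _]mxE /flux mulrCA -expr2 mulr_ge0 ?g_ge0 ?sqr_ge0.
have pp_le : dot p p <= L * dot (K *m u) p.
  rewrite !dotE mulr_sumr; apply: ler_sum => i _.
  by rewrite -expr2 ![p _ _]mxE sqr_flux_le.
have KTp_le : dot (K^T *m p) (K^T *m p) <= S ^+ 2 * dot p p.
  rewrite -!sqr_norm2 -exprMn ler_sqr ?nnegrE ?norm2_trmx_mulmx_le//.
    exact: norm2_ge0.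
  by rewrite mulr_ge0 ?norm2_ge0 ?spectral_norm_ge0.
have KTp_le_vp : tau * dot (K^T *m p) (K^T *m p) <= 2 * dot (K *m u) p.
  rewrite (@le_trans _ _ (tau * (L * S ^+ 2) * dot (K *m u) p))//.
    rewrite -mulrA ler_pM2l// (le_trans KTp_le)//.
    have -> : L * S ^+ 2 * dot (K *m u) p = S ^+ 2 * (L * dot (K *m u) p).
      by ring.
    by rewrite ler_wpM2l ?sqr_ge0.
  exact: ler_wpM2r.
have := ler_wpM2l (ltW tau_gt0) KTp_le_vp.
lra.
Qed.

Theorem theorem2 (R : realType) (a b : R) (hab : a < b)
    (M : nat) (alpha : 'I_M.+1 -> R)
    (N : nat) (K : 'M[R]_N) (hK : convolution_matrix a b alpha K)
    (tau : R) (tau_gt0 : 0 < tau)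
    (g : R -> R) (hg : diffusivity g)
    (L : R) (hL : L.-lipschitz (flux g))
    (htau : (tau%:E <= 2%:E * ((L * spectral_norm K ^+ 2)%:E)^-1)%E) :
  (forall n : nat, continuous (diffusion_network tau K g n)) /\
  (forall (f : 'cV[R]_N) (k : nat),
     norm2 (diffusion_network tau K g k.+1 f)
       <= norm2 (diffusion_network tau K g k f)).
Proof.
split=> [n|f k].
  elim: n => [|n IHn] u; first exact: cvg_id.
  apply: continuous_comp; first exact: IHn.
  apply: continuous_diffusion_block; exact: klipschitz_continuous hL.
(* A Lipschitz bound between 0 and 1 forces L to be nonnegative. *)
have L_ge0 : 0 <= L.
  have := flux_lipschitz_le _ _ hL 1; rewrite normr1 mulr1.
  exact: le_trans.
rewrite /diffusion_network iterS.
apply: (diffusion_block_norm2_le _ _ L) => //.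
  exact: diffusivity_ge0 hg.
by apply: step_size_le htau; rewrite mulr_ge0 ?sqr_ge0.
Qed.
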